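(* Let $X$ be a star Menger space. Then every open $F_\sigma$-subset of $X$, with the subspace topology, is star Menger. In particular, every clopen subset of $X$ and every cozero set of $X$ is star Menger.
   Context: All spaces are assumed to be regular and $T_1$. For a family $\mathcal{U}$ of subsets of $X$ and $A\subseteq X$, $St(A,\mathcal{U})=\bigcup\{U\in\mathcal{U}:U\cap A\neq\emptyset\}$. A space $M$ is Menger if for every sequence $\{\mathcal{U}_n:n\in\omega\}$ of open covers of $M$ there are finite subcollections $\mathcal{V}_n\subseteq\mathcal{U}_n$ ($n\in\omega$) such that $\bigcup\{\mathcal{V}_n:n\in\omega\}$ is an open cover of $M$. A space $X$ is star Menger if for every open cover $\mathcal{U}$ of $X$ there is a subspace $M\subseteq X$ which is Menger and satisfies $St(M,\mathcal{U})=X$. A cozero set of $X$ is a set of the form $X\setminus f^{-1}(0)$ with $f:X\to\mathbb{R}$ continuous. *)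

(* Defs.v *)
From mathcomp Require Import all_boot all_order all_algebra.
From mathcomp Require Import all_classical reals topology normedtype.
From mathcomp Require Export borel_hierarchy.

Set Implicit Arguments.
Unset Strict Implicit.
Unset Printing Implicit Defensive.

Import GRing.Theory Num.Theory.
Import numFieldNormedType.Exports.

Local Open Scope classical_set_scope.
Local Open Scope ring_scope.

Definition star (X : Type) (A : set X) (U : set (set X)) : set X :=
  \bigcup_(V in [set V | U V /\ V `&` A !=set0]) V.

Definition open_cover (X : topologicalType) (U : set (set X)) : Prop :=
  (forall V, U V -> open V) /\ \bigcup_(V in U) V = [set: X].

Definition menger (X : topologicalType) : Prop :=
  forall U : nat -> set (set X), (forall n, open_cover (U n)) ->
  exists V : nat -> set (set X),
    (forall n, V n `<=` U n /\ finite_set (V n)) /\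
    open_cover (\bigcup_n V n).

(* [set_type M] carries the initial topology of its inclusion into [X]. *)
Definition star_menger (X : topologicalType) : Prop :=
  forall U : set (set X), open_cover U ->
  exists M : set X, menger (set_type M) /\ star M U = [set: X].

Definition cozero (R : realType) (X : topologicalType) (A : set X) : Prop :=
  exists2 f : X -> R, continuous f & A = ~` (f @^-1` [set 0]).

(* Main.v *)
(** Write the open set [S] as the union of closed sets [F n]. For an open cover
    [U] of [S], star-Mengerness of [X] applied to [U] together with the single
    set [X \ F n] gives a Menger [M n] whose star contains [F n]; a member of
    the cover meeting [F n] must come from [U], hence lies in [S], so
    [M n ∩ S] already has a star containing [F n]. As [M n ∩ S] is the union
    over [k] of the closed subspaces [M n ∩ F k] of [M n], the union of all
    [M n ∩ F k] is a Menger subspace of [S] whose star is [S]. *)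

Require Import Defs.
From mathcomp Require Import all_boot all_order all_algebra.
From mathcomp Require Import all_classical reals topology normedtype.

Local Open Scope classical_set_scope.

Import Order.TTheory GRing.Theory Num.Theory.
Import numFieldNormedType.Exports.

(* Mengerness of a subspace expressed with open sets of the ambient space, so
   that closed subsets, unions and nested subspaces need no coercions. *)
Definition menger_set {X : topologicalType} (A : set X) : Prop :=
  forall U : nat -> set (set X),
  (forall n V, U n V -> open V) ->
  (forall n, A `<=` \bigcup_(V in U n) V) ->
  exists2 V : nat -> set (set X),
    forall n, V n `<=` U n /\ finite_set (V n) &
    A `<=` \bigcup_n \bigcup_(W in V n) W.

Lemma mengerE (X : topologicalType) : menger X <-> menger_set [set: X].
Proof.
split=> H U.
- move=> oU cU; have [|V [HV [_ cV]]] := H U.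
    by move=> n; split; [exact: oU|rewrite -subTset; exact: cU].
  exists V => // x; rewrite -cV => -[W [n _ VW] Wx].
  by exists n => //; exists W.
- move=> HU; have [n W|n|V HV cV] := H U.
  + by case: (HU n) => + _; apply.
  + by rewrite (HU n).2.
  exists V; split=> //; split.
    by move=> W [n _ VW]; apply: (HU n).1; apply: (HV n).1.
  rewrite -subTset => x /cV[n _ [W VW Wx]].
  by exists W => //; exists n.
Qed.

(** Pull the covers back along [f], select there, and return to the sets they came from. *)
Lemma menger_set_image {X Y : topologicalType} (f : X -> Y) (A : set X) :
  continuous f -> menger_set A -> menger_set (f @` A).
Proof.
move=> /continuousP cf mA U oU cU.
have [_ _ [O /oU oO <-]|n x Ax|V HV cV] := mA (fun n => preimage f @` U n).
- exact: cf.
- have [O UO Ofx] := cU n _ (imageP f Ax).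
  by exists (f @^-1` O) => //; exists O.
(* Many members of [U n] may share the preimage [W]; keeping just one of them preserves
   finiteness. *)
pose h n W := get [set O | U n O /\ f @^-1` O = W].
have hP n W : V n W -> U n (h n W) /\ f @^-1` (h n W) = W.
  move=> /(HV n).1[O UO fO].
  apply: (@getPex _ [set O | U n O /\ f @^-1` O = W]).
  by exists O.
exists (fun n => h n @` V n) => [n|_ [x /cV[n _ [W VW Wx]] <-]].
  split; last by apply: finite_image; exact: (HV n).2.
  by move=> _ [W /hP[+ _] <-].
exists n => //; exists (h n W); first exact: imageP.
by rewrite -[h n W _]/((f @^-1` h n W) x) (hP n W VW).2.
Qed.

(** The hypothesis holds for subspace inclusions. Cover the image by all open sets whose preimage
    lies in [U n]; preimages of the selected sets then do the job. *)
Lemma menger_set_initial {X Y : topologicalType} (f : X -> Y) (A : set X) :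
  (forall V : set X, open V -> exists2 O, open O & f @^-1` O = V) ->
  menger_set (f @` A) -> menger_set A.
Proof.
move=> fop mfA U oU cU.
have [n O []//|n _ [x /(cU n)[V UV Vx] <-]|V HV cV] :=
    mfA (fun n => [set O | open O /\ U n (f @^-1` O)]).
  have [O oO fO] := fop _ (oU n _ UV).
  by exists O; [split=> //; rewrite fO|move: Vx; rewrite -fO].
exists (fun n => preimage f @` V n) => [n|x Ax].
  split; last by apply: finite_image; exact: (HV n).2.
  by move=> _ [O /(HV n).1[_ UO] <-].
have [n _ [O VO Ofx]] := cV _ (imageP f Ax).
by exists n => //; exists (f @^-1` O) => //; exists O.
Qed.

Lemma menger_set_val {X : topologicalType} {S : set X} (A : set S) :
  menger_set A <-> menger_set (set_val @` A).
Proof.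
split; first exact/menger_set_image/initial_continuous.
by apply: menger_set_initial => V [O oO OV]; exists O.
Qed.

Lemma menger_subspaceE {X : topologicalType} (A : set X) :
  menger A <-> menger_set A.
Proof.
have AE : set_val @` [set: A] = A.
  apply/seteqP; split=> [_ [a _ <-]|x Ax]; first exact: set_valP.
  by exists (SigSub (mem_set Ax)).
by rewrite mengerE menger_set_val AE.
Qed.

Lemma menger_setI_closed {X : topologicalType} (A F : set X) :
  closed F -> menger_set A -> menger_set (A `&` F).
Proof.
move=> cF mA U oU cU.
have [n V [/oU//|->]|n x Ax|V HV cV] := mA (fun n => U n `|` [set ~` F]).
- exact: closed_openC.
- have [Fx|nFx] := pselect (F x).
    by have [V UV Vx] := cU n x (conj Ax Fx); exists V => //; left.
  by exists (~` F) => //; right.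
exists (fun n => V n `&` U n) => [n|x [/cV[n _ [W VW Wx]] Fx]].
  by split=> [W []//|]; apply: finite_setIl; exact: (HV n).2.
exists n => //; exists W => //; split=> //.
by have [//|WF] := (HV n).1 W VW; move: Wx; rewrite WF.
Qed.

Lemma menger_set_bigcup {X : topologicalType} (A : nat -> set X) :
  (forall k, menger_set (A k)) -> menger_set (\bigcup_k A k).
Proof.
move=> mA U oU cU.
(* The [k]-th set only uses the covers from index [k] on, so that each cover is
   used finitely many times. *)
have /choice[V VP] k : exists V : nat -> set (set X),
    (forall n, V n `<=` U (k + n)%N /\ finite_set (V n)) /\
    A k `<=` \bigcup_n \bigcup_(W in V n) W.
  have [n W|n x Ax|V] := mA k (fun n => U (k + n)%N); first exact: oU.
    by apply: cU; exists k.
  by exists V.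
(* Index [n - k] of [V k] refers to the cover [U n], and [k <= n] leaves finitely many terms. *)
exists (fun n => \bigcup_(k in `I_n.+1) V k (n - k)%N).
  move=> n; split.
    move=> W [k /= kn VW]; rewrite -(subnKC (kn : k <= n)%N).
    exact: ((VP k).1 _).1.
  by apply: bigcup_finite => [|k _]; [exact: finite_II|exact: ((VP k).1 _).2].
move=> x [k _ /(VP k).2[n _ [W VW Wx]]].
exists (k + n)%N => //; exists W => //; exists k; last by rewrite addKn.
by rewrite /= ltnS leq_addr.
Qed.

Lemma star_menger_open_Fsigma {X : topologicalType} (S : set X) :
  star_menger X -> open S -> Fsigma S -> star_menger S.
Proof.
move=> smX oS [F cF SF] U [oU cU].
have FS n : F n `<=` S by rewrite SF => x Fx; exists n.
have /choice[M MP] n : exists M : set X, menger_set M /\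
    forall x : S, F n (set_val x) ->
    exists2 V, U V & V x /\ exists2 y, V y & M (set_val y).
  (* [G] is [U] transported to [X]; its members stay open because [S] is open. *)
  pose G := [set O | open O /\ exists2 V, U V & O = set_val @` V].
  have [|M [/menger_subspaceE mM sM]] := smX (G `|` [set ~` F n]).
    split=> [V [[]//|->]|]; first exact: closed_openC.
    rewrite -subTset => x _; have [Fx|nFx] := pselect (F n x); last first.
      by exists (~` F n) => //; right.
    have : [set: S] (SigSub (mem_set (FS _ _ Fx))) by [].
    rewrite -cU => -[V UV Vx]; exists (set_val @` V); last first.
      by exists (SigSub (mem_set (FS _ _ Fx))).
    left; split; last by exists V.
    have [O oO OV] := oU _ UV.
    suff -> : set_val @` V = O `&` S by exact: openI.
    rewrite -OV; apply/seteqP; split=> [_ [y Oy <-]|y [Oy Sy]].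
      by split=> //; exact: set_valP.
    by exists (SigSub (mem_set Sy)).
  exists M; split=> // x Fx.
  have : [set: X] (set_val x) by [].
  (* [W] cannot be the complement of [F n], which misses [x]. So [W] is the image of some [V] in
     [U], and its common point with [M] lies in [S]. *)
  rewrite -sM => -[W [[[_ [V UV ->]]|->]]]; last by move=> _; case.
  move=> [_ [[y Vy <-] My]] [z Vz /val_inj zx].
  by exists V => //; split; [rewrite -zx|exists y].
exists (set_val @^-1` (\bigcup_n \bigcup_k (M n `&` F k))); split.
  apply/menger_subspaceE/menger_set_val.
  have -> : set_val @` (@set_val _ S @^-1` (\bigcup_n \bigcup_k (M n `&` F k)))
      = \bigcup_n \bigcup_k (M n `&` F k).
    apply/seteqP; split=> [_ [x Mx <-]//|x Mx].
    suff Sx : S x by exists (SigSub (mem_set Sx)).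
    by case: Mx => n _ [k _ [_ /FS]].
  apply: menger_set_bigcup => n; apply: menger_set_bigcup => k.
  by apply: menger_setI_closed => //; exact: (MP n).1.
rewrite -subTset => x _.
have [n _ Fx] : (\bigcup_n F n) (set_val x) by rewrite -SF; exact: set_valP.
have [V UV [Vx [y Vy My]]] := (MP n).2 x Fx.
exists V => //; split=> //; exists y; split=> //.
have [k _ Fy] : (\bigcup_n F n) (set_val y) by rewrite -SF; exact: set_valP.
by exists n => //; exists k.
Qed.

Lemma cozero_open (R : realType) {X : topologicalType} (S : set X) :
  cozero R S -> open S.
Proof.
move=> [f cf ->]; rewrite openC.
by apply: closed_comp => [x _|]; [exact: cf|exact: closed_eq].
Qed.

(** By the Archimedean property, [f x] is nonzero exactly when its absolute value is at least some
    [1/(n+1)], a closed condition for each [n]. *)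
Lemma cozero_Fsigma (R : realType) {X : topologicalType} (S : set X) :
  cozero R S -> Fsigma S.
Proof.
move=> [f cf ->]; exists (fun n => [set x | n.+1%:R^-1 <= `|f x|]%R) => [n|].
  apply: (closed_comp (f := fun x => `|f x|%R)
    (D := [set y | n.+1%:R^-1 <= y]%R)).
    by move=> x _; apply: continuous_comp; [exact: cf|exact: norm_continuous].
  exact: closed_ge.
apply/seteqP; split=> [x /= /eqP|x [n _ /= nfx] fx0].
  rewrite -normr_gt0 => /ltr_add_invr[n]; rewrite add0r => /ltW nfx.
  by exists n.
by move: nfx; rewrite fx0 normr0 invr_le0 lern0.
Qed.

Theorem proposition4p4 (R : realType) (X : topologicalType)
    (regX : regular_space X) (T1X : accessible_space X)
    (smX : star_menger X) :
  (forall S : set X, open S -> Fsigma S -> star_menger (set_type S)) /\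
  (forall S : set X, clopen S -> star_menger (set_type S)) /\
  (forall S : set X, cozero R S -> star_menger (set_type S)).
Proof.
split=> [S|]; first exact: star_menger_open_Fsigma.
split=> [S [oS cS]|S zS]; apply: star_menger_open_Fsigma => //.
- exact: closed_Fsigma.
- exact: cozero_open zS.
- exact: cozero_Fsigma zS.
Qed.
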